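(* For any wheel $W_n$ of order $n\geq 4$, $\gamma_{\times 3R}(W_n)=2n-2\left\lfloor\frac{n-1}{3}\right\rfloor$.
   Context: For a finite simple graph $G=(V,E)$ with minimum degree at least $2$, a Roman $3$-tuple dominating function on $G$ is a function $f\colon V\to\{0,1,2\}$ such that every vertex $v$ with $f(v)=0$ has at least $3$ neighbors $w$ with $f(w)=2$, and every vertex $v$ with $f(v)\neq 0$ has at least $2$ neighbors $w$ with $f(w)=2$. The weight of $f$ is $f(V)=\sum_{v\in V}f(v)$, and $\gamma_{\times 3R}(G)$ is the minimum weight of a Roman $3$-tuple dominating function on $G$. The wheel $W_n$ of order $n\geq 4$ has vertex set $\{v_0,v_1,\dots,v_{n-1}\}$, where $v_1,\dots,v_{n-1}$ form a cycle of length $n-1$ in this cyclic order and $v_0$ is adjacent to all of $v_1,\dots,v_{n-1}$. *)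

(* Defs.v *)
From mathcomp Require Import all_boot.
From mathcomp Require Import zify.

Set Implicit Arguments.
Unset Strict Implicit.
Unset Printing Implicit Defensive.

Record sgraph := SGraph {
  svertex :> finType;
  adj : rel svertex;
  adj_sym : symmetric adj;
  adj_irrefl : irreflexive adj
}.

Definition nbhd (G : sgraph) (v : G) : {set G} := [set w | adj v w].

Definition min_degree_ge (G : sgraph) (d : nat) : Prop :=
  forall v : G, d <= #|nbhd v|.

(* Functions V -> {0,1,2} are finite functions into 'I_3, whose elements
   coerce to the natural numbers 0, 1, 2. *)
Definition nbhd2 (G : sgraph) (f : {ffun G -> 'I_3}) (v : G) : {set G} :=
  [set w in nbhd v | f w == 2 :> nat].

Definition roman3_dom (G : sgraph) (f : {ffun G -> 'I_3}) : bool :=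
  [forall v : G,
     ((f v == 0 :> nat) ==> (3 <= #|nbhd2 f v|)) &&
     ((f v != 0 :> nat) ==> (2 <= #|nbhd2 f v|))].

Definition weight (G : sgraph) (f : {ffun G -> 'I_3}) : nat :=
  \sum_(v : G) f v.

Definition all_two (G : sgraph) : {ffun G -> 'I_3} := [ffun => ord_max].

(* The constant function 2 only serves as a witness that the minimum ranges
   over a nonempty set; it is one when the minimum degree is at least 2, and
   only then is the value meaningful (see [roman3_domination_numberP]). *)
Definition roman3_domination_number (G : sgraph) : nat :=
  weight [arg min_(f < all_two G | roman3_dom f) weight f].

Lemma all_two_roman3_dom (G : sgraph) :
  min_degree_ge G 2 -> roman3_dom (all_two G).
Proof.
move=> dG; apply/forallP => v; rewrite !ffunE /=.
have -> // : nbhd2 (all_two G) v = nbhd v.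
by apply/setP => w; rewrite !inE ffunE andbT.
Qed.

Lemma roman3_domination_numberP (G : sgraph) : min_degree_ge G 2 ->
  (exists2 f : {ffun G -> 'I_3},
     roman3_dom f & weight f = roman3_domination_number G) /\
  (forall f : {ffun G -> 'I_3},
     roman3_dom f -> roman3_domination_number G <= weight f).
Proof.
move=> /all_two_roman3_dom d2; rewrite /roman3_domination_number.
by case: arg_minnP => // f df minf; split=> //; exists f.
Qed.

(* [rim_next n i j]: on the rim v_1, ..., v_(n-1), the vertex v_j comes right
   after v_i in the cyclic order. *)
Definition rim_next (n i j : nat) : bool :=
  (0 < i) && (j == if i.+1 < n then i.+1 else 1).

(* The vertex v_i is i : 'I_n, with hub v_0. The conjunct i != j only rules
   out degenerate loops (at the hub, and on the rim when n = 2). *)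
Definition wheel_adj (n : nat) (i j : 'I_n) : bool :=
  (i != j) &&
  [|| i == 0 :> nat, j == 0 :> nat, rim_next n i j | rim_next n j i].

Lemma wheel_adj_sym (n : nat) : symmetric (@wheel_adj n).
Proof.
move=> i j; rewrite /wheel_adj eq_sym; congr (_ && _).
by rewrite orbCA [rim_next n i j || _]orbC.
Qed.

Lemma wheel_adj_irrefl (n : nat) : irreflexive (@wheel_adj n).
Proof. by move=> i; rewrite /wheel_adj eqxx. Qed.

Definition wheel (n : nat) : sgraph :=
  SGraph (@wheel_adj_sym n) (@wheel_adj_irrefl n).

Lemma wheel_min_degree (n : nat) : 4 <= n -> min_degree_ge (wheel n) 2.
Proof.
move=> n4 v.
have two (a b : wheel n) : a != b -> adj v a -> adj v b -> 2 <= #|nbhd v|.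
  move=> ab va vb; have <- : #|[set a; b]| = 2 by rewrite cards2 ab.
  by apply/subset_leq_card/subsetP => w; rewrite !inE => /orP[] /eqP->.
have [n0 n1 n2] : [/\ 0 < n, 1 < n & 2 < n] by split; lia.
have [v0 | v_gt0] := posnP (v : 'I_n).
  apply: (two (Ordinal n1) (Ordinal n2)) => //;
    by rewrite /= /wheel_adj -val_eqE /= v0.
have vn := ltn_ord (v : 'I_n).
have sn : (if (v : 'I_n).+1 < n then (v : 'I_n).+1 else 1) < n by case: ifP.
apply: (two (Ordinal n0) (Ordinal sn)).
- by rewrite -val_eqE /=; case: ifP.
- by rewrite /= /wheel_adj -val_eqE /= orbT andbT -lt0n.
- rewrite /= /wheel_adj /rim_next -val_eqE /= v_gt0 eqxx !orbT andbT.
  by case: ifP; lia.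
Qed.

(* Main.v *)
Require Import Defs.
From mathcomp Require Import all_boot.
From mathcomp Require Import zify.

Set Implicit Arguments.
Unset Strict Implicit.
Unset Printing Implicit Defensive.

(** When the hub has value 2, every three cyclically consecutive rim vertices
    have total value at least 4, and there are two adjacent rim vertices of
    value 2. Writing n - 1 = 3k + r with r < 3, remove r consecutive rim
    vertices of value 2 and cut the rest of the rim into k triples: the rim
    weighs at least 4k + 2r. When the hub has another value, all rim vertices
    must have value 2. Equality holds for the function vanishing exactly on
    v_3, v_6, v_9, ... and equal to 2 elsewhere. *)

(** Moving the window one step drops [a s] and gains [a (s + m)], which are equal by periodicity. *)
Lemma sum_shift_periodic (m : nat) (a : nat -> nat) (s : nat) :
  (forall i, a (i + m) = a i) -> \sum_(i < m) a (s + i) = \sum_(i < m) a i.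
Proof.
move=> per; elim: s => [|s <-]; first by [].
case: m per => [|m] per; first by rewrite !big_ord0.
rewrite big_ord_recr big_ord_recl /= addnC addn0 addSnnS per; congr (_ + _).
by apply: eq_bigr => i _; rewrite addSnnS.
Qed.

Lemma sum_triples_ge (c k s : nat) (a : nat -> nat) :
  (forall i, c <= a i + a i.+1 + a i.+2) -> c * k <= \sum_(i < 3 * k) a (s + i).
Proof.
move=> tri; elim: k => [|k IHk]; first by rewrite muln0.
rewrite (_ : 3 * k.+1 = (3 * k).+3); last by lia.
by rewrite mulnSr !big_ord_recr /= !addnS -!addnA leq_add // addnA tri.
Qed.

(** The last two hypotheses are what domination demands of the rim values once the hub counts as one
    neighbour of value 2: a zero needs both rim neighbours, any vertex at least one. *)
Lemma cyclic_sum_ge (m : nat) (a : nat -> nat) :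
    (forall i, a (i + m) = a i) ->
    (forall i, a i.+1 = 0 -> a i = 2 /\ a i.+2 = 2) ->
    (forall i, a i = 2 \/ a i.+2 = 2) ->
  2 * (m - m %/ 3) <= \sum_(i < m) a i.
Proof.
have [-> // | m_gt0] := posnP m; move=> per zero nonzero.
(* The zero condition covers only successors; periodicity turns [i] into the successor [i + m]. *)
have zero_next i : a i = 0 -> a i.+1 = 2.
  rewrite -(per i) -(per i.+1) addSn -(prednK m_gt0) addnS.
  by case/zero.
have tri i : 4 <= a i + a i.+1 + a i.+2.
  by have := zero i; have := nonzero i; have := zero i.+1;
     have := zero_next i; lia.
have [p ap aSp] : exists2 p, a p = 2 & a p.+1 = 2.
  have [j aj] : exists j, a j.+1 = 2.
    by case: (nonzero 1) => ?; [exists 0 | exists 2].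
  by case: (nonzero j) => ?; [exists j | exists j.+1].
(* Starting the sum at [p] puts the two adjacent 2s first, ready to absorb the remainder of [m]
   modulo 3. *)
rewrite -(sum_shift_periodic p per).
have := ltn_pmod m (isT : 0 < 3); have := divn_eq m 3.
move: (m %/ 3) (m %% 3) => k [|[|[|//]]] Em _; subst m;
  rewrite [k * 3]mulnC.
- by rewrite addn0; have := sum_triples_ge k p tri; lia.
- rewrite addn1 big_ord_recl /= addn0 ap.
  under eq_bigr => i _ do rewrite /bump add1n -addSnnS.
  by rewrite (_ : _ * _ = 2 + 4 * k) ?leq_add2l ?sum_triples_ge //; lia.
rewrite addn2 !big_ord_recl /= addn0 addn1 ap aSp.
under eq_bigr => i _ do rewrite /bump !add1n -!addSnnS.
by rewrite (_ : _ * _ = 2 + (2 + 4 * k)) ?leq_add2l ?sum_triples_ge //; lia.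
Qed.

(* The rim is indexed from 0 and modulo m, so that v_(i+1) is [rim m i]. *)
Definition rim (m i : nat) : wheel m.+1 := inord (i %% m).+1 : 'I_m.+1.

Definition hub (m : nat) : wheel m.+1 := ord0 : 'I_m.+1.

Section Wheel.

Variable m : nat.
Hypothesis m_ge3 : 3 <= m.

Implicit Type f : {ffun wheel m.+1 -> 'I_3}.

Lemma val_rim i : (rim m i : 'I_m.+1) = (i %% m).+1 :> nat.
Proof. by rewrite inordK // ltnS ltn_pmod //; lia. Qed.

Lemma rim_periodic i : rim m (i + m) = rim m i.
Proof. by rewrite /rim modnDr. Qed.

(** Leaves [i %% m] as the only residue, so that adjacency on the rim becomes a case analysis for
    [lia]. *)
Lemma modnS_wrap i :
  i.+1 %% m = if (i %% m).+1 < m then (i %% m).+1 else 0.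
Proof.
have im : i %% m < m by rewrite ltn_pmod //; lia.
rewrite -addn1 -modnDml addn1; case: ltnP => [/modn_small //|mi].
by rewrite (_ : (i %% m).+1 = m) ?modnn //; lia.
Qed.

Lemma nbhd_rim i : nbhd (rim m i.+1) = [set hub m; rim m i; rim m i.+2].
Proof.
apply/setP => w; rewrite !inE /= /wheel_adj /rim_next.
rewrite -!(inj_eq (@ord_inj m.+1)) !val_rim !modnS_wrap /=.
have im : i %% m < m by rewrite ltn_pmod //; lia.
have := ltn_ord (w : 'I_m.+1).
move: (i %% m) im (nat_of_ord w) => x xm y ym.
by repeat case: ifP; lia.
Qed.

Lemma card_nbhd2_rim f i :
  #|nbhd2 f (rim m i.+1)| =
  (f (hub m) == 2 :> nat) + (f (rim m i) == 2 :> nat)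
  + (f (rim m i.+2) == 2 :> nat).
Proof.
rewrite /nbhd2 nbhd_rim -sum1_card.
under eq_bigl => w do rewrite inE.
rewrite big_mkcondr /= -setUA !big_setU1 ?big_set1 /=.
- by rewrite addnA; do 3!case: eqP.
(* The two rim neighbours are distinct because [m] is at least 3. *)
- rewrite !inE -(inj_eq (@ord_inj m.+1)) !val_rim !modnS_wrap.
  have im : i %% m < m by rewrite ltn_pmod //; lia.
  by repeat case: ifP; lia.
- by rewrite !inE -!(inj_eq (@ord_inj m.+1)) !val_rim.
Qed.

Lemma weight_wheel f : weight f = f (hub m) + \sum_(i < m) f (rim m i).
Proof.
rewrite /weight big_ord_recl; congr (_ + _); apply: eq_bigr => i _.
congr (nat_of_ord (f _)); apply: ord_inj.
by rewrite val_rim modn_small.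
Qed.

Lemma roman3_dom_weight_ge f :
  roman3_dom f -> 2 * (m.+1 - m %/ 3) <= weight f.
Proof.
move=> /forallP domf; rewrite weight_wheel.
have cond i := domf (rim m i.+1).
have [h2 | h2] := eqVneq (f (hub m) : nat) 2.
  suff : 2 * (m - m %/ 3) <= \sum_(i < m) f (rim m i) by lia.
  apply: (@cyclic_sum_ge m (fun i => f (rim m i))) => i.
  - by rewrite rim_periodic.
  - by move: (cond i); rewrite card_nbhd2_rim; lia.
  - by move: (cond i); rewrite card_nbhd2_rim; lia.
have rim2 i : f (rim m i) = 2 :> nat.
  by move: (cond i); rewrite card_nbhd2_rim; lia.
(* The rim alone weighs [2 * m], which suffices since [m %/ 3] is at least 1. *)
under eq_bigr => i _ do rewrite rim2.
by rewrite sum_nat_const card_ord; lia.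
Qed.

Definition opt_fun : {ffun wheel m.+1 -> 'I_3} :=
  [ffun v : 'I_m.+1 => if (0 < v) && (3 %| v) then ord0 else ord_max].

Lemma opt_fun_rim i :
  opt_fun (rim m i) = (if 3 %| (i %% m).+1 then 0 else 2) :> nat.
Proof. by rewrite ffunE val_rim /=; case: ifP. Qed.

Lemma opt_fun_hub : opt_fun (hub m) = 2 :> nat.
Proof. by rewrite ffunE. Qed.

Lemma rimP (v : wheel m.+1) : v = hub m \/ exists i, v = rim m i.+1.
Proof.
have [v0 | v0] := posnP (v : 'I_m.+1); first by left; apply: ord_inj.
(* The index wanted is [v - 2] modulo [m]; adding [m] avoids truncated subtraction at [v = 1]. *)
right; exists ((v : 'I_m.+1) + m - 2); apply: ord_inj; rewrite val_rim.
have vm := ltn_ord (v : 'I_m.+1).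
rewrite (_ : (_ - 2).+1 = (v : 'I_m.+1).-1 + m); last by lia.
by rewrite modnDr modn_small; lia.
Qed.

(** Zeros on the rim are at least 3 steps apart, also across the wrap since v_1 and v_2 have value
    2. So a zero has two rim neighbours of value 2, and every rim vertex has at least one. *)
Lemma opt_fun_dom : roman3_dom opt_fun.
Proof.
apply/forallP => v; case: (rimP v) => [-> | [i ->]]; last first.
  rewrite card_nbhd2_rim opt_fun_hub !opt_fun_rim !modnS_wrap.
  have im : i %% m < m by rewrite ltn_pmod //; lia.
  by repeat case: ifP; lia.
rewrite opt_fun_hub /=.
(* The hub has value 2, so v_1 and v_2 are enough for it. *)
have rim01 : rim m 0 != rim m 1.
  by rewrite -(inj_eq (@ord_inj m.+1)) !val_rim !modn_small //; lia.
have <- : #|[set rim m 0; rim m 1]| = 2 by rewrite cards2 rim01.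
apply/subset_leq_card/subsetP => w; rewrite !inE => /orP[] /eqP->;
  by rewrite opt_fun_rim /= /wheel_adj -(inj_eq (@ord_inj m.+1)) val_rim
             modn_small //; lia.
Qed.

Lemma sum_nonmultiples3 k :
  \sum_(i < k) (if 3 %| i.+1 then 0 else 2) = 2 * (k - k %/ 3).
Proof.
elim: k => [|k IHk]; first by rewrite big_ord0.
by rewrite big_ord_recr /= IHk; case: ifP; lia.
Qed.

Lemma weight_opt_fun : weight opt_fun = 2 * (m.+1 - m %/ 3).
Proof.
rewrite weight_wheel opt_fun_hub.
under eq_bigr => i _ do rewrite opt_fun_rim modn_small //.
by rewrite sum_nonmultiples3; lia.
Qed.

End Wheel.

Theorem proposition12 (n : nat) (hn : 4 <= n) :
  roman3_domination_number (wheel n) = 2 * n - 2 * ((n - 1) %/ 3).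
Proof.
case: n hn => // m m_ge3; rewrite subn1 -mulnBr /=.
have [[f domf <-] minf] := roman3_domination_numberP (wheel_min_degree m_ge3).
apply/eqP; rewrite eqn_leq (roman3_dom_weight_ge m_ge3 domf) andbT.
by rewrite -weight_opt_fun // minf // opt_fun_dom.
Qed.
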